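(* Let $(X,T)$ be a topological dynamical system and let $K$ be a non-empty compact subset of $X$. Then $$h_{top}^{\widetilde{B}}(T,K)=\lim_{\epsilon \to 0}\sup\{\underline{h}_{\mu}^{\widetilde{BK}}(T,\epsilon):\mu\in \mathcal{M}(X),\ \mu(K)=1\}=\lim_{\epsilon \to 0}\sup\{h_{\mu}^{\widetilde{K}}(T,\epsilon):\mu\in \mathcal{M}(X),\ \mu(K)=1\}.$$
   Context: A topological dynamical system $(X,T)$ consists of a compact metric space $X$ with metric $d$ and a continuous map $T:X\to X$. $\mathcal{M}(X)$ is the set of all Borel probability measures on $X$ (not necessarily $T$-invariant). Quantities below take values in $[0,\infty]$; $\inf\emptyset=\infty$, $\sup\emptyset=0$, $-\log 0=\infty$; $n$, $N$, $n_i$ denote positive integers. For $n\ge 1$, $d_n(x,y)=\max_{0\le j\le n-1}d(T^jx,T^jy)$. The neutralized Bowen open ball is $B_n(x,e^{-n\epsilon})=\{y\in X: d_n(x,y)<e^{-n\epsilon}\}$, for $\epsilon>0$. Neutralized Bowen topological entropy: for a non-empty subset $Z\subset X$, $\epsilon>0$, $N\ge 1$, $s\ge 0$, put $M_{N,\epsilon}^s(Z)=\inf\sum_{i\in I}e^{-n_is}$, where the infimum is over all finite or countable covers $\{B_{n_i}(x_i,e^{-n_i\epsilon})\}_{i\in I}$ of $Z$ with $n_i\ge N$, $x_i\in X$. This is non-decreasing in $N$; put $M_\epsilon^s(Z)=\lim_{N\to\infty}M_{N,\epsilon}^s(Z)$. Let $M_\epsilon(Z)=\inf\{s:M_\epsilon^s(Z)=0\}=\sup\{s:M_\epsilon^s(Z)=\infty\}$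 be the critical value of $s$ at which $M_\epsilon^s(Z)$ jumps from $\infty$ to $0$. Then $h_{top}^{\widetilde B}(T,Z)=\lim_{\epsilon\to0}M_\epsilon(Z)=\inf_{\epsilon>0}M_\epsilon(Z)$. Lower neutralized Brin-Katok local entropy at scale $\epsilon$: for $\mu\in\mathcal M(X)$ and $\epsilon>0$, $$\underline{h}_{\mu}^{\widetilde{BK}}(T,\epsilon)=\int\liminf_{n\to\infty}-\frac{\log\mu(B_n(x,e^{-n\epsilon}))}{n}\,d\mu(x).$$ Neutralized Katok entropy at scale $\epsilon$: for $\mu\in\mathcal M(X)$, $\epsilon>0$, $s\ge0$, $N\ge 1$, $\delta\in(0,1)$, put $\Lambda_{N,\epsilon}^s(\mu,\delta)=\inf\sum_{i\in I}e^{-n_is}$, where the infimum is over all finite or countable families $\{B_{n_i}(x_i,e^{-n_i\epsilon})\}_{i\in I}$ with $n_i\ge N$, $x_i\in X$ and $\mu(\bigcup_{i\in I}B_{n_i}(x_i,e^{-n_i\epsilon}))>1-\delta$. Put $\Lambda_\epsilon^s(\mu,\delta)=\lim_{N\to\infty}\Lambda_{N,\epsilon}^s(\mu,\delta)$, let $\Lambda_\epsilon(\mu,\delta)=\inf\{s:\Lambda_\epsilon^s(\mu,\delta)=0\}=\sup\{s:\Lambda_\epsilon^s(\mu,\delta)=\infty\}$, and $h_\mu^{\widetilde K}(T,\epsilon)=\lim_{\delta\to0}\Lambda_\epsilon(\mu,\delta)$. *)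

(* Defs.v *)
From HB Require Import structures.
From mathcomp Require Import all_boot all_order all_algebra.
From mathcomp Require Import all_classical all_reals all_analysis.

Set Implicit Arguments.
Unset Strict Implicit.
Unset Printing Implicit Defensive.

Import Order.TTheory GRing.Theory Num.Theory.
Import numFieldNormedType.Exports.

Local Open Scope classical_set_scope.
Local Open Scope ring_scope.

(* Measurable types are pointed, so metric spaces carrying Borel measures are
   pointed too; the base point plays no role in any definition below. *)
#[short(type="pmetricType")]
HB.structure Definition PMetric (R : numDomainType) :=
  {X of Pointed X & Metric R X}.

Notation borel X := (g_sigma_algebraType (@open X)).

Section neutralized_entropy.
Context {R : realType} {X : pmetricType R}.
Variable T : X -> X.

(* The default value 0 of the maximum is harmless since distances are
   nonnegative. *)
Definition bowen_dist (n : nat) (x y : X) : R :=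
  \big[Num.max/0]_(j < n) mdist (iter j T x) (iter j T y).

Definition neutralized_ball (n : nat) (eps : R) (x : X) : set X :=
  [set y | bowen_dist n x y < expR (- (n%:R * eps))].

(* Finite or countable families of balls are indexed by arbitrary subsets I of
   nat. The predicate P constrains the union of the family. *)
Definition family_inf (P : set X -> Prop) (N : nat) (eps s : R) : \bar R :=
  ereal_inf [set r | exists (I : set nat) (n : nat -> nat) (x : nat -> X),
    [/\ forall i, I i -> (0 < n i)%N /\ (N <= n i)%N,
        P (\bigcup_(i in I) neutralized_ball (n i) eps (x i)) &
        r = \esum_(i in I) (expR (- ((n i)%:R * s)))%:E]].

Definition family_lim (P : set X -> Prop) (eps s : R) : \bar R :=
  limn (fun N => family_inf P N eps s).

(* In this library ereal_inf set0 = +oo. *)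
Definition critical_value (m : R -> \bar R) : \bar R :=
  ereal_inf [set s%:E | s in [set s : R | 0 <= s /\ m s = 0%E]].

Definition bowen_entropy_at (Z : set X) (eps : R) : \bar R :=
  critical_value (family_lim (fun U => Z `<=` U) eps).

Definition bowen_entropy (Z : set X) : \bar R :=
  lim (bowen_entropy_at Z eps @[eps --> 0^'+]).

(* The liminf does not see the junk term at n = 0, and lne 0 = -oo. *)
Definition lower_brin_katok_entropy (mu : probability (borel X) R) (eps : R)
    : \bar R :=
  (\int[mu]_x limn_einf (fun n : nat =>
     - lne (mu (neutralized_ball n eps x)) * (n%:R^-1)%:E))%E.

Definition katok_entropy_at (mu : probability (borel X) R) (eps delta : R)
    : \bar R :=
  critical_value (family_lim (fun U => ((1 - delta)%:E < mu U)%E) eps).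

Definition katok_entropy (mu : probability (borel X) R) (eps : R) : \bar R :=
  lim (katok_entropy_at mu eps delta @[delta --> 0^'+]).

End neutralized_entropy.

(* Main.v *)
(* Fix eps and a set K with positive covering number for exponent s at scale
   eps / 2 and times at least N. For each L, take a finite subset F of K that
   is e^(-(N+L) eps)-dense for d_(N+L), and load its points greedily with the
   largest weights for which every ball B_n(y, e^(-n eps)), y in F, N <= n <= N
   + L, has mass at most e^(-n s). Then every point of F lies in a ball of mass
   exactly e^(-n s). A Vitali selection among these balls is disjoint while its
   enlargements cover K, so the total mass is bounded below by the covering
   number, uniformly in L; thus no linear programming duality is needed. An
   ultralimit of the normalized weights is a finitely additive probability on
   all subsets of X. Caratheodory's construction, applied to its inner
   approximation by closed sets, yields a Borel probability that does not
   exceed it on open sets, hence carried by K and of lower local entropy at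
   least s everywhere, at scale 2 eps. Conversely, if the Katok entropy at
   scale eps is below s, there are families of balls of almost full measure and
   small weight. By Borel-Cantelli almost every x lies, for arbitrarily large
   n, in a ball B of the family with mu(B) > e^(-n s), and B is contained in
   B_n(x, e^(-n eps / 2)), so the lower local entropy at scale eps / 2 is at
   most s almost everywhere. The three quantities thus interlace up to constant
   factors on eps. *)
Require Import Defs.
From HB Require Import structures.
From mathcomp Require Import all_boot all_order all_algebra.
From mathcomp Require Import all_classical all_reals all_analysis.
From mathcomp Require Import finmap lra measurable_realfun.

Set Implicit Arguments.
Unset Strict Implicit.
Unset Printing Implicit Defensive.

Import Order.TTheory GRing.Theory Num.Theory.
Import numFieldNormedType.Exports.

Local Open Scope classical_set_scope.
Local Open Scope ring_scope.

(** * Finitely additive probabilities on all subsets *)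

Record is_content (R : realType) (T : Type) (phi : set T -> R) : Prop :=
  IsContent {
    contentT : phi setT = 1;
    content_ge0 : forall A, 0 <= phi A;
    contentU : forall A B, A `&` B = set0 -> phi (A `|` B) = phi A + phi B }.

Section content_theory.
Context {R : realType} {T : Type} (phi : set T -> R).
Hypothesis phiP : is_content phi.

Lemma content0 : phi set0 = 0.
Proof.
have := contentU phiP (setIid set0); rewrite setUid.
by move/eqP; rewrite -subr_eq0 opprD addNKr oppr_eq0 => /eqP.
Qed.

Lemma le_content A B : A `<=` B -> phi A <= phi B.
Proof.
move=> AB; rewrite -(setDUK AB) (contentU phiP) ?lerDl ?(content_ge0 phiP)//.
by rewrite setDE setICA setICr setI0.
Qed.

Lemma contentU_le A B : phi (A `|` B) <= phi A + phi B.
Proof.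
rewrite -(setDUK (@subsetUl _ A B)) (contentU phiP); last first.
  by rewrite setDE setICA setICr setI0.
by rewrite lerD2l le_content// setDUD setDv set0U; exact: subDsetl.
Qed.

Lemma content_bigcup_le (F : nat -> set T) n :
  phi (\bigcup_(i in `I_n) F i) <= \sum_(i < n) phi (F i).
Proof.
elim: n => [|n ih]; first by rewrite II0 bigcup_set0 content0 big_ord0.
rewrite big_ord_recr/= IIS bigcup_setU bigcup_set1.
by rewrite (le_trans (contentU_le _ _))// lerD2r.
Qed.

End content_theory.

(** * From a finitely additive probability to a Borel probability *)

(** By regularity each point of [C] has a closed neighbourhood inside some [U i]. Finitely many of
    these cover [C], and [D i] is the union of those assigned to the index [i]. This is how
    compactness turns finite subadditivity of a content into countable subadditivity. *)
Lemma closed_cover_shrink (X : puniformType) (C : set X) (U : nat -> set X) :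
  compact C -> (forall i, open (U i)) -> C `<=` \bigcup_i U i ->
  exists n (D : nat -> set X),
    [/\ forall i, closed (D i), forall i, D i `<=` U i &
        C `<=` \bigcup_(i in `I_n) D i].
Proof.
move=> cC oU CU.
have /choice[f fP] x : exists p : nat * set X, C x ->
    [/\ nbhs x p.2, closed p.2 & p.2 `<=` U p.1].
  have [Cx|nCx] := pselect (C x); last by exists (0%N, set0).
  have [i _ Uix] := CU _ Cx.
  have [V Vx VU] :=
    @uniform_regular X x (U i) (open_nbhs_nbhs (conj (oU i) Uix)).
  exists (i, closure V) => _; split => //=; last exact: closed_closure.
  exact: filterS (@subset_closure _ V) Vx.
move: (cC); rewrite compact_cover => /(_ X C (fun x => interior (f x).2)).
case=> [x _|x Cx|S SC CS]; first exact: open_interior.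
  by exists x => //; have [+ _ _] := fP _ Cx.
exists (\max_(x <- enum_fset S) (f x).1).+1,
  (fun i => \bigcup_(x in [set x | x \in S /\ (f x).1 = i]) (f x).2).
split=> [i|i|x Cx].
- apply: closed_bigcup => [|x [xS _]].
    by apply: (@sub_finite_set _ _ [set` S]) => // x [].
  by have [] := fP x (set_mem (SC _ xS)).
- by move=> y [x [xS <-]]; have [_ _] := fP x (set_mem (SC _ xS)); apply.
- have [y /= yS xy] := CS _ Cx; exists (f y).1 => /=.
    by rewrite ltnS; apply: (@leq_bigmax_seq _ _ xpredT (fun x => (f x).1)).
  by exists y => //; exact: interior_subset xy.
Qed.

Section content_measure.
Context {R : realType} {X : pmetricType R} (phi : set X -> R).
Hypothesis cX : compact [set: X].
Hypothesis phiP : is_content phi.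
Local Open Scope ereal_scope.

Definition inner_content (U : set X) : \bar R :=
  ereal_sup [set (phi C)%:E | C in [set C | closed C /\ C `<=` U]].

Definition outer_content (A : set X) : \bar R :=
  ereal_inf [set inner_content U | U in [set U | open U /\ A `<=` U]].

Let closed_compact (C : set X) : closed C -> compact C.
Proof. by move=> cC; exact: subclosed_compact cC cX _. Qed.

Lemma inner_content_ge0 U : 0 <= inner_content U.
Proof.
apply: ereal_sup_ubound; exists set0; last by rewrite content0.
by split; [exact: closed0|].
Qed.

Lemma inner_content_le U : inner_content U <= (phi U)%:E.
Proof.
by apply: ge_ereal_sup => _ [C [_ CU] <-]; rewrite lee_fin le_content.
Qed.

Lemma le_inner_content U V : U `<=` V -> inner_content U <= inner_content V.
Proof.
move=> UV; apply: ereal_sup_le => _ [C [cC CU] <-]; exists C => //.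
by split => //; exact: subset_trans UV.
Qed.

Lemma inner_content_bigcup (U : nat -> set X) : (forall i, open (U i)) ->
  inner_content (\bigcup_i U i) <= \sum_(i <oo) inner_content (U i).
Proof.
move=> oU; apply: ge_ereal_sup => _ [C [cC CU] <-].
have [n [D [cD DU CD]]] := closed_cover_shrink (closed_compact cC) oU CU.
apply: (@le_trans _ _ (\sum_(i < n) (phi (D i))%:E)).
  rewrite sumEFin lee_fin (le_trans (le_content phiP CD))//.
  exact: content_bigcup_le.
rewrite (@le_trans _ _ (\sum_(0 <= i < n) inner_content (U i)))//.
  rewrite big_mkord; apply: lee_sum => i _; apply: ereal_sup_ubound.
  by exists (D i).
by apply: nneseries_lim_ge => i _ _; exact: inner_content_ge0.
Qed.

Lemma outer_content_ge0 A : 0 <= outer_content A.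
Proof.
by apply: le_ereal_inf_tmp => _ [U _ <-]; exact: inner_content_ge0.
Qed.

Lemma le_outer_content A B : A `<=` B -> outer_content A <= outer_content B.
Proof.
move=> AB; apply: ereal_inf_le_tmp => _ [U [oU BU] <-]; exists U => //.
by split => //; exact: subset_trans BU.
Qed.

Lemma outer_content_open U : open U -> outer_content U = inner_content U.
Proof.
move=> oU; apply/eqP; rewrite eq_le; apply/andP; split.
  by apply: ereal_inf_lbound; exists U => //; split.
by apply: le_ereal_inf_tmp => _ [V [_ UV] <-]; exact: le_inner_content.
Qed.

Lemma outer_contentT : outer_content setT = 1.
Proof.
rewrite outer_content_open; last exact: openT.
apply/eqP; rewrite eq_le; apply/andP; split.
  by rewrite (le_trans (inner_content_le _))// (contentT phiP).
apply: ereal_sup_ubound; exists setT; last by rewrite (contentT phiP).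
by split => //; exact: closedT.
Qed.

Lemma outer_content0 : outer_content set0 = 0.
Proof.
apply/eqP; rewrite eq_le outer_content_ge0 andbT.
rewrite outer_content_open; last exact: open0.
by rewrite (le_trans (inner_content_le _))// content0.
Qed.

Lemma outer_content_fin A : outer_content A \is a fin_num.
Proof.
rewrite fin_numElt (lt_le_trans _ (outer_content_ge0 A)) ?ltNy0//=.
rewrite (le_lt_trans (le_outer_content (@subsetT _ A)))//.
by rewrite outer_contentT ltry.
Qed.

Lemma outer_content_sigma_subadditive : sigma_subadditive outer_content.
Proof.
move=> F; apply/lee_addgt0Pr => e e0.
rewrite (le_trans _ (epsilon_trick _ _ (ltW e0)))//; last first.
  by move=> n; exact: outer_content_ge0.
have /choice[U UP] n : exists U, [/\ open U, F n `<=` U &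
    inner_content U <= outer_content (F n) + (e / (2 ^ n.+1)%:R)%:E].
  have en0 : (0 < e / (2 ^ n.+1)%:R)%R by rewrite divr_gt0// ltr0n expn_gt0.
  have [_ [U [oU FU] <-] /ltW U_] :=
    lb_ereal_inf_adherent en0 (outer_content_fin (F n)).
  by exists U.
apply: (@le_trans _ _ (inner_content (\bigcup_n U n))).
  rewrite -outer_content_open; last first.
    by apply: bigcup_open => i _; have [] := UP i.
  by apply: le_outer_content; apply: subset_bigcup => i _; have [] := UP i.
rewrite (le_trans (inner_content_bigcup _))//.
  by move=> i; have [] := UP i.
apply: lee_nneseries => [i _ _|i _]; first exact: inner_content_ge0.
by have [] := UP i.
Qed.

(** Let [V] be an open set containing [A]. For [C] closed in the intersection of [V] and [U], the
    rest of [V] outside [U] lies in [V] minus [C], which is open. Any closed [D] in there is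
    disjoint from [C], and the union of the two is a closed subset of [V], so additivity of [phi]
    bounds the sum by [inner_content V]. *)
Lemma outer_content_caratheodory U A : open U ->
  outer_content (A `&` U) + outer_content (A `&` ~` U) <= outer_content A.
Proof.
move=> oU; apply: le_ereal_inf_tmp => _ [V [oV AV] <-].
apply: (@le_trans _ _
  (inner_content (V `&` U) + outer_content (V `&` ~` U))).
  rewrite -outer_content_open; last exact: openI.
  by apply: leeD; apply: le_outer_content; exact: setSI.
rewrite -leeBrDr ?outer_content_fin//.
apply: ge_ereal_sup => _ [C [cC CVU] <-].
rewrite leeBrDr ?outer_content_fin// addeC -leeBrDr//.
apply: (@le_trans _ _ (inner_content (V `&` ~` C))).
  rewrite -outer_content_open; last by apply: openI => //; exact: closed_openC.
  apply: le_outer_content => x [Vx Ux]; split => // Cx; apply: Ux.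
  by have [] := CVU _ Cx.
apply: ge_ereal_sup => _ [D [cD DVC] <-].
rewrite leeBrDr// -EFinD -(contentU phiP).
  apply: ereal_sup_ubound; exists (D `|` C) => //; split; first exact: closedU.
  by move=> x [/DVC[]|/CVU[]].
by rewrite -subset0 => x [/DVC[]].
Qed.

(** The comparison is stated on open sets, where the outer measure equals [inner_content]. It is
    applied to the complement of [K] and to Bowen balls, which are open. *)
Lemma content_measure : exists mu : probability (borel X) R,
  forall U : set X, open U -> mu U <= (phi U)%:E.
Proof.
pose nu : {outer_measure set X -> \bar R} := HB.pack outer_content
  (isOuterMeasure.Build R X outer_content outer_content0 outer_content_ge0
    le_outer_content outer_content_sigma_subadditive).
(* Caratheodory measurable sets form a sigma-algebra, so it is enough to test the generating open
   sets. *)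
have mnu (A : set (borel X)) : measurable A -> nu.-cara.-measurable A.
  move: A; apply: smallest_sub; first exact: sigma_algebra_measurable.
  move=> U oU; apply: le_caratheodory_measurable => A.
  exact: outer_content_caratheodory.
pose m : set (borel X) -> \bar R := outer_content.
have m_sigma : semi_sigma_additive m.
  move=> F mF tF mUF; apply: (@caratheodory_measure_sigma_additive R X nu) => //.
  - by move=> i; exact: mnu.
  - exact: mnu.
pose mM := isMeasure.Build _ (borel X) R m outer_content0 outer_content_ge0 m_sigma.
pose mm : {measure set (borel X) -> \bar R} := HB.pack m mM.
pose mP := Measure_isProbability.Build _ (borel X) R mm outer_contentT.
pose mu : probability (borel X) R := HB.pack m mM mP.
exists mu => U oU; rewrite /mu/= /m outer_content_open//.
exact: inner_content_le.
Qed.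

End content_measure.

(** * Ultralimits of finitely additive probabilities *)

Lemma ultrafilter_cvg (I : Type) (T : topologicalType) (G : set_system I)
    (K : set T) (f : I -> T) : UltraFilter G -> compact K ->
  (forall i, K (f i)) -> exists l : T, f @ G --> l.
Proof.
move=> GU cK fK; have GP : ProperFilter G by exact: ultra_proper.
have [l [_ fl]] : K `&` cluster (f @ G) !=set0.
  apply: cK; suff : G (f @^-1` K) by [].
  by apply: (filterS _ (@filterT _ G _)) => i _; exact: fK.
exists l => V lV.
(* The ultrafilter contains the preimage of [V] or that of its complement; the latter would
   contradict that [l] is a cluster point. *)
have [//|GV] := in_ultra_setVsetC (f @^-1` V) GU.
have : G (f @^-1` (~` V)) by [].
by move=> /(fl _ _)/(_ lV)[x []].
Qed.

(** A limit is required for all subsets [A] at once, possibly uncountably many, hence an ultrafilter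
    instead of a subsequence. It refines the filter of cofinal ranges of integers, so bounds that
    hold eventually pass to the limit. *)
Lemma content_ultralimit (R : realType) (T : Type) (m : nat -> set T -> R) :
  (forall n, is_content (m n)) ->
  exists phi, is_content phi /\
    forall A c, (\forall n \near \oo, m n A <= c) -> phi A <= c.
Proof.
move=> mP; have [G [GU ooG]] := ultraFilterLemma eventually_filter.
have GP : ProperFilter G by exact: ultra_proper.
have /choice[phi phiP] A : exists l : R, m ^~ A @ G --> l.
  apply: (ultrafilter_cvg GU (@segment_compact R 0 1)) => n /=.
  rewrite in_itv/= (content_ge0 (mP n))/= -(contentT (mP n)).
  exact: le_content.
exists phi; split; last first.
  by move=> A c Ac; apply: (cvgr_to_le (phiP A)); exact: ooG.
split.
- have m1 : m ^~ setT @ G --> (1 : R).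
    by under eq_cvg do rewrite (contentT (mP _)); exact: cvg_cst.
  exact: cvg_unique (phiP setT) m1.
- move=> A; apply: (cvgr_to_ge (phiP A)); apply: nearW => n.
  exact: (content_ge0 (mP n)).
- move=> A B AB; have mAB : m ^~ (A `|` B) @ G --> phi A + phi B.
    under eq_cvg do rewrite (contentU (mP _) AB).
    exact: cvgD.
  exact: cvg_unique (phiP _) mAB.
Qed.

(** * Finite point masses: greedy saturation and Vitali selection *)

Section point_masses.
Context {R : realType} {T : eqType}.
Implicit Types (ps : seq (T * R)) (A B : set T).

Definition mass ps A : R := \sum_(p <- ps) p.2 * \1_A p.1.

Definition nonneg_weights ps := all (fun p => 0 <= p.2) ps.

Lemma mass_ge0 ps A : nonneg_weights ps -> 0 <= mass ps A.
Proof.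
rewrite /mass => /allP ps0; rewrite big_seq; apply: sumr_ge0 => p /ps0 p0.
by rewrite mulr_ge0// indicE ler0n.
Qed.

Lemma mass_cons p ps A : mass (p :: ps) A = p.2 * \1_A p.1 + mass ps A.
Proof. by rewrite /mass big_cons. Qed.

Lemma massU ps A B : A `&` B = set0 ->
  mass ps (A `|` B) = mass ps A + mass ps B.
Proof.
move=> AB; rewrite /mass -big_split/=; apply: eq_bigr => p _.
rewrite -mulrDr; congr (_ * _); rewrite !indicE in_setU.
have [pA|pA] := boolP (p.1 \in A); have [pB|pB] := boolP (p.1 \in B);
  rewrite ?addr0 ?add0r//.
by have : (A `&` B) p.1 by [split; exact: set_mem]; rewrite AB.
Qed.

Lemma le_mass ps A B : nonneg_weights ps -> A `<=` B -> mass ps A <= mass ps B.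
Proof.
move=> ps0 AB; rewrite -(setDUK AB) massU ?lerDl ?mass_ge0//.
by rewrite setDE setICA setICr setI0.
Qed.

End point_masses.

Lemma seq_argmin d (V : orderType d) (I : eqType) (f : I -> V) (P : I -> Prop)
    (s : seq I) : (exists2 i, i \in s & P i) ->
  exists i, [/\ i \in s, P i & forall j, j \in s -> P j -> (f i <= f j)%O].
Proof.
elim: s => [[]//|a s ih] [i0 i0as Pi0].
have [/ih[i [si Pi imin]]|sP] := pselect (exists2 i, i \in s & P i).
  have [aP|aP] := pselect (P a /\ (f a <= f i)%O).
    exists a; split; [exact: mem_head|by case: aP|] => j.
    rewrite inE => /predU1P[->//|sj Pj].
    by rewrite (le_trans aP.2)// imin.
  exists i; split => // [|j]; first by rewrite inE si orbT.
  rewrite inE => /predU1P[-> Pa|sj Pj]; last exact: imin.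
  by case: (leP (f i) (f a)) => // /ltW fai; case: aP.
exists a; split; first exact: mem_head.
  move: i0as; rewrite inE => /predU1P[<-//|si0].
  by case: sP; exists i0.
move=> j; rewrite inE => /predU1P[->//|sj Pj].
by case: sP; exists j.
Qed.

(* The weights are chosen greedily, one point after the other: each new point
   receives the largest weight that the constraints allow, which makes one of
   them tight. *)
Lemma saturated_weights (R : realType) (T I : eqType) (js : seq I)
    (B : I -> set T) (b : I -> R) (F : seq T) :
  (forall j, j \in js -> 0 <= b j) ->
  (forall x, x \in F -> exists2 j, j \in js & B j x) ->
  exists ps : seq (T * R),
    [/\ nonneg_weights ps, {in ps, forall p, p.1 \in F},
        forall j, j \in js -> mass ps (B j) <= b j &
        forall x, x \in F ->
          exists j, [/\ j \in js, B j x & mass ps (B j) = b j]].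
Proof.
move=> b0; elim: F => [_|x F ih FB].
  by exists [::]; split => // j jjs; rewrite /mass big_nil b0.
have [y yF|ps [ps0 psF psb psT]] := ih.
  by apply: FB; rewrite inE yF orbT.
have [i [ijs Bix imin]] :=
  @seq_argmin _ _ _ (fun j => b j - mass ps (B j)) (B ^~ x) js
    (FB x (mem_head _ _)).
set w := b i - mass ps (B i) in imin.
have w0 : 0 <= w by rewrite subr_ge0 psb.
have psb' j : j \in js -> mass ((x, w) :: ps) (B j) <= b j.
  move=> jjs; rewrite mass_cons/= indicE.
  have [/set_mem Bjx|_] := boolP (x \in B j); last by rewrite mulr0 add0r psb.
  by rewrite mulr1 -lerBrDr imin.
exists ((x, w) :: ps); split => //=.
- by rewrite /nonneg_weights/= w0.
- move=> p; rewrite in_cons => /predU1P[->|/psF pF]; first exact: mem_head.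
  exact: (@mem_behead _ (x :: F)).
- move=> y; rewrite inE => /predU1P[->|/psT[j [jjs Bjy jb]]].
    exists i; split => //.
    by rewrite mass_cons/= indicE mem_set// mulr1 subrK.
  (* A constraint that was tight stays tight: the new weight is nonnegative, so the mass can only
     grow, while [psb'] still bounds it by [b j]. *)
  exists j; split => //; apply/eqP; rewrite eq_le psb'//= -jb mass_cons/=.
  by rewrite lerDr mulr_ge0// indicE ler0n.
Qed.

(* Vitali's covering lemma: the index [j] of smallest rank is kept and the sets
   that meet [B j] are discarded. *)
Lemma vitali_mass (R : realType) (T I : eqType) (ps : seq (T * R))
    (js : seq I) (B : I -> set T) (rk : I -> nat) :
  nonneg_weights ps -> (forall j, j \in js -> B j !=set0) ->
  exists ks : seq I,
    [/\ {subset ks <= js},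
        forall j, j \in js ->
          exists k, [/\ k \in ks, (rk k <= rk j)%N & B k `&` B j !=set0] &
        \sum_(k <- ks) mass ps (B k) <=
          mass ps (\bigcup_(j in [set` js]) B j)].
Proof.
move=> ps0; have [n] := ubnP (size js); elim: n js => // n ih js jsn Bn0.
have [js0|[i [ijs _ imin]]] : js = [::] \/
    exists i, [/\ i \in js, True & forall j, j \in js -> True -> (rk i <= rk j)%O].
- case: js {jsn Bn0} => [|a s]; [by left|right].
  by apply: seq_argmin; exists a => //; exact: mem_head.
- by exists [::]; split; rewrite js0// big_nil mass_ge0.
pose disj j := `[< B i `&` B j = set0 >].
have sub : {subset [seq j <- js | disj j] <= js}.
  by move=> j; rewrite mem_filter => /andP[].
have [||ks [ksjs ksB ksm]] := ih [seq j <- js | disj j].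
(* The filtered list is strictly shorter, because [B i] is non-empty and therefore meets itself. *)
- rewrite -ltnS (leq_trans _ jsn)// ltnS size_filter -(count_predC disj js).
  rewrite -addn1 leq_add2l -has_count; apply/hasP; exists i => //=.
  apply/asboolPn; rewrite setIid => Bi0.
  by have [x] := Bn0 _ ijs; rewrite Bi0.
- by move=> j /sub; exact: Bn0.
exists (i :: ks); split.
- by move=> j; rewrite inE => /predU1P[->//|/ksjs/sub].
- move=> j jjs; have [dj|/asboolPn/eqP/set0P ndj] := boolP (disj j).
    have [|k [kks kj Bkj]] := ksB j; first by rewrite mem_filter dj.
    by exists k; split => //; rewrite inE kks orbT.
  by exists i; split; [exact: mem_head|exact: imin|].
- rewrite big_cons (le_trans (lerD (lexx _) ksm))// -massU.
    apply: le_mass => // x [Bix|[j /sub jjs Bjx]]; first by exists i.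
    by exists j.
  rewrite -subset0 => x [Bix [j /=]].
  rewrite mem_filter => /andP[/asboolP Bij _ Bjx].
  by have : (B i `&` B j) x by []; rewrite Bij.
Qed.

(** * Bowen metrics and families of neutralized balls *)

Section bowen_metric.
Context {R : realType} {X : pmetricType R} (T : X -> X).
Implicit Types (x y z : X) (n m : nat).

Lemma bowen_dist_ltP n x y r : 0 < r ->
  bowen_dist T n x y < r <->
  forall j, (j < n)%N -> mdist (iter j T x) (iter j T y) < r.
Proof.
move=> r0; split => [/bigmax_ltP[_ xy] j jn|xy].
  exact: (xy (Ordinal jn)).
by apply/bigmax_ltP; split => // j _; exact: xy.
Qed.

Lemma bowen_dist_sym n x y : bowen_dist T n x y = bowen_dist T n y x.
Proof. by apply: eq_bigr => j _; rewrite metric_sym. Qed.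

Lemma bowen_distxx n x : bowen_dist T n x x = 0.
Proof.
apply/eqP; rewrite eq_le bigmax_ge_id andbT.
by apply: bigmax_le => // j _; rewrite mdistxx.
Qed.

Lemma bowen_dist_triangle n x y z :
  bowen_dist T n x z <= bowen_dist T n x y + bowen_dist T n y z.
Proof.
apply: bigmax_le => [|j _].
  by rewrite addr_ge0//; exact: bigmax_ge_id.
rewrite (le_trans (metric_triangle _ (iter j T y) _))//.
by rewrite lerD//; apply: (le_bigmax _ (fun j : 'I_n => mdist _ _) j).
Qed.

Lemma le_bowen_dist n m x y : (n <= m)%N ->
  bowen_dist T n x y <= bowen_dist T m x y.
Proof.
move=> nm; apply: bigmax_le => [|j _]; first exact: bigmax_ge_id.
exact: (le_bigmax _ (fun j : 'I_m => mdist (iter j T x) (iter j T y))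
  (widen_ord nm j)).
Qed.

Hypothesis cT : continuous T.

Lemma open_bowen_ball n x r : open [set y | bowen_dist T n x y < r].
Proof.
have [r0|r0] := ltP 0 r; last first.
  suff -> : [set y | bowen_dist T n x y < r] = set0 by exact: open0.
  rewrite -subset0 => y /=; rewrite ltNge => /negP; apply.
  by rewrite (le_trans r0)//; exact: bigmax_ge_id.
have -> : [set y | bowen_dist T n x y < r] = \bigcap_(j in `I_n)
    (iter j T @^-1` [set y | mdist (iter j T x) y < r]).
  by apply/seteqP; split => y /=; rewrite bowen_dist_ltP.
rewrite bigcap_mkord; apply: big_ind => [|A B|j _]; [exact: openT|exact: openI|].
apply: open_comp => [y _|].
  elim: (j : nat) y => [|k ih] y; first exact: cvg_id.
  by apply: continuous_comp; [exact: ih|exact: cT].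
rewrite openE => y /= xy; rewrite /interior.
apply/nbhs_ballP; exists (r - mdist (iter j T x) y); rewrite /= ?subr_gt0//.
rewrite ballEmdist => z /=; rewrite ltrBrDl; apply: le_lt_trans.
exact: metric_triangle.
Qed.

Lemma bowen_net (K : set X) n r : compact K -> 0 < r ->
  exists F : seq X, (forall x, x \in F -> K x) /\
    forall y, K y -> exists2 x, x \in F & bowen_dist T n x y < r.
Proof.
rewrite compact_cover => cK r0.
have [x _|y Ky|F FK KF] := cK _ K (fun x => [set y | bowen_dist T n x y < r]).
- exact: open_bowen_ball.
- by exists y => //=; rewrite bowen_distxx.
- exists (finmap.enum_fset F); split => [x xF|y /KF[x xF xy]].
    exact: set_mem (FK _ xF).
  by exists x.
Qed.

End bowen_metric.

Section neutralized_families.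
Context {R : realType} {X : pmetricType R} (T : X -> X).

Lemma neutralized_ball_center n (eps : R) (x : X) :
  neutralized_ball T n eps x x.
Proof. by rewrite /neutralized_ball/= bowen_distxx expR_gt0. Qed.

Lemma family_inf_le_sum (P : set X -> Prop) N (eps s : R) (ks : seq (nat * X)) :
  (forall k, k \in ks -> (0 < k.1)%N /\ (N <= k.1)%N) ->
  P (\bigcup_(k in [set` ks]) neutralized_ball T k.1 eps k.2) ->
  (family_inf T P N eps s <= (\sum_(k <- ks) expR (- (k.1%:R * s)))%:E)%E.
Proof.
move=> ksN Pks; pose k0 : nat * X := (0%N, point).
apply: ereal_inf_lbound.
exists `I_(size ks), (fun i => (nth k0 ks i).1), (fun i => (nth k0 ks i).2).
split => [i /= iks||].
- by apply: ksN; exact: mem_nth.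
- congr P: Pks; apply/seteqP; split => x [k /= kks kx].
    by exists (index k ks); rewrite /= ?index_mem// nth_index.
  by exists (nth k0 ks k) => //=; exact: mem_nth.
- have ge0 i : i \in `I_(size ks) ->
      (0 <= (expR (- ((nth k0 ks i).1%:R * s)))%:E)%E.
    by rewrite lee_fin expR_ge0.
  by rewrite (esum_fset _ ge0)// -fsbig_ord sumEFin (big_nth k0) big_mkord.
Qed.

End neutralized_families.

(** * A Frostman lemma for neutralized balls *)

Section frostman.
Context {R : realType} {X : pmetricType R} (T : X -> X) (K : set X).
Hypothesis cT : continuous T.
Hypothesis cK : compact K.
Variables (eps s c : R) (N : nat).
Hypothesis eps0 : 0 < eps.
Hypothesis N0 : (0 < N)%N.
Hypothesis N4 : 4 <= expR (N%:R * (eps / 2)).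
Hypothesis cN : (c%:E <= family_inf T (fun U => K `<=` U) N (eps / 2) s)%E.

Let expR_le n m : (n <= m)%N -> expR (- (m%:R * eps)) <= expR (- (n%:R * eps)).
Proof. by move=> nm; rewrite ler_expR lerN2 ler_pM2r// ler_nat. Qed.

(** Four is the number of radii in the chain of triangle inequalities of the Vitali step below.
    Halving [eps] in the exponent absorbs this factor as soon as [n] is large. *)
Let expR4 n : (N <= n)%N ->
  4 * expR (- (n%:R * eps)) <= expR (- (n%:R * (eps / 2))).
Proof.
move=> Nn; rewrite {1}[eps]splitr mulrDr opprD expRD mulrA.
rewrite ler_piMl ?expR_ge0// expRN ler_pdivrMr ?expR_gt0// mul1r.
by rewrite (le_trans N4)// ler_expR ler_pM2r ?divr_gt0// ler_nat.
Qed.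

Lemma frostman_weights L : exists ps : seq (X * R),
  [/\ nonneg_weights ps, {in ps, forall p, K p.1}, c <= mass ps setT &
      forall n x, (N <= n <= N + L)%N ->
        mass ps (neutralized_ball T n (eps *+ 2) x) <= expR (- (n%:R * s))].
Proof.
have [F [FK KF]] := bowen_net cT (N + L)%N cK (expR_gt0 (- ((N + L)%:R * eps))).
pose js := [seq (n, y) | n <- iota N L.+1, y <- F].
have jsP n y : ((n, y) \in js) = (N <= n <= N + L)%N && (y \in F).
  rewrite -[(n <= N + L)%N]ltnS -addnS -mem_iota.
  apply/allpairsP/andP => [[[n' y'] [/= ? ? [-> ->]]]//|[nN yF]].
  by exists (n, y).
pose B (j : nat * X) := neutralized_ball T j.1 eps j.2.
pose b (j : nat * X) : R := expR (- (j.1%:R * s)).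
have [j _|x xF|ps [ps0 psF psb psT]] := @saturated_weights R X _ js B b F.
- exact: expR_ge0.
- exists (N, x); last exact: neutralized_ball_center.
  by rewrite jsP leqnn leq_addr.
exists ps; split => //.
- by move=> p /psF/FK.
(* The selection runs over tight balls only, so that each selected ball pays for its own term of the
   covering sum. The rank is the time: a smaller time means a coarser metric and a larger radius, so
   a selected ball dominates those that it meets. *)
- pose tight j := mass ps (B j) == b j.
  have [j _|ks [ksjs ksB ksm]] :=
      @vitali_mass R X _ ps [seq j <- js | tight j] B fst ps0.
    by exists j.2; exact: neutralized_ball_center.
  have ksP k : k \in ks -> [/\ (N <= k.1)%N, (k.1 <= N + L)%N & tight k].
    case: k => n y /ksjs; rewrite mem_filter jsP/=.
    by move=> /andP[-> /andP[/andP[]]].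
  rewrite -lee_fin (le_trans cN)//.
  rewrite (le_trans (@family_inf_le_sum _ _ _ _ _ _ _ ks _ _))//.
  + by move=> k /ksP[Nk _ _]; split => //; exact: leq_trans Nk.
  + move=> y /KF[x xF xy].
    have [[n z] [jjs Bjx tj]] := psT _ xF.
    have [|k [kks /= kn [w [kw zw]]]] := ksB (n, z).
      by rewrite mem_filter jjs andbT; exact/eqP.
    exists k => //; move: (jjs); rewrite jsP => /andP[/andP[Nn nL] _].
    have [Nk _ _] := ksP _ kks.
    rewrite /neutralized_ball/= (lt_le_trans _ (expR4 Nk))//.
    rewrite /B/neutralized_ball/= in kw zw Bjx.
    (* The chain runs from [k.2] through [w], [z] and [x] to [y]. Its links are measured in the
       metric of time [k.1] and bounded by the radii at times [k.1], [n], [n] and [N + L], each at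
       most the radius at time [k.1]. *)
    have h1 := bowen_dist_triangle T k.1 k.2 w y.
    have h2 := bowen_dist_triangle T k.1 w z y.
    rewrite (bowen_dist_sym T k.1 w z) in h2.
    have h3 := bowen_dist_triangle T k.1 z x y.
    have h4 := le_bowen_dist T z w kn.
    have h5 := le_bowen_dist T z x kn.
    have h6 := le_bowen_dist T x y (leq_trans kn nL).
    have h7 := expR_le kn.
    have h8 := expR_le (leq_trans kn nL).
    lra.
  + rewrite lee_fin.
    apply: le_trans (le_trans ksm (le_mass ps0 (@subsetT _ _))).
    by rewrite !big_seq; apply: ler_sum => k /ksP[_ _ /eqP ->].
- move=> n x NnL; case/andP: (NnL) => Nn nL.
  (* The constraints concern balls centred in [F], whereas [x] is arbitrary. If the ball at scale
     [eps *+ 2] contains a charged point [p.1], it lies in the ball at scale [eps] about [p.1];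
     otherwise its mass is 0. *)
  have [[p [/psF pF px]]|nps] := pselect
      (exists p, p \in ps /\ neutralized_ball T n (eps *+ 2) x p.1).
    have js1 : (n, p.1) \in js by rewrite jsP NnL.
    apply: le_trans (psb _ js1); apply: le_mass => // y.
    rewrite /neutralized_ball/= in px *; rewrite /B/neutralized_ball/= => xy.
    have h1 := bowen_dist_triangle T n p.1 x y.
    rewrite bowen_dist_sym in px.
    have h2 : expR (- (n%:R * (eps *+ 2))) *+ 2 <= expR (- (n%:R * eps)) :> R.
      have e1 : expR (- (n%:R * (eps / 2))) <= 1 :> R.
        by rewrite -expR0 ler_expR oppr_le0 mulr_ge0// divr_ge0// ltW.
      have e4 := expR4 Nn; have e0 := expR_ge0 (- (n%:R * eps)).
      rewrite [eps *+ 2]mulr2n mulrDr opprD expRD -mulrnAr.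
      apply: ler_piMr => //; lra.
    lra.
  rewrite /mass big_seq big1 ?expR_ge0// => p pps.
  rewrite indicE; case: (boolP (p.1 \in _)) => [/set_mem px|].
    by case: nps; exists p.
  by rewrite mulr0.
Qed.

Lemma frostman (cX : compact [set: X]) : 0 < c ->
  exists mu : probability (borel X) R, mu K = 1%E /\
    forall n x, (N <= n)%N ->
      (mu (neutralized_ball T n (eps *+ 2) x) <= (expR (- (n%:R * s)) / c)%:E)%E.
Proof.
move=> c0; have /choice[ps psP] := frostman_weights.
have M0 L : 0 < mass (ps L) setT by have [_ _ /(lt_le_trans c0)] := psP L.
pose m L A := mass (ps L) A / mass (ps L) setT.
have mP L : is_content (m L).
  have [ps0 _ _ _] := psP L; split => [|A|A B AB].
  - by rewrite /m divff// gt_eqF.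
  - by rewrite divr_ge0 ?mass_ge0.
  - by rewrite /m massU// mulrDl.
have [phi [phiP phi_le]] := content_ultralimit mP.
have [mu mu_le] := content_measure cX phiP.
have oK : open (~` K).
  by apply: closed_openC; apply: compact_closed => //; exact: metric_hausdorff.
have mK : measurable (K : set (borel X)).
  by rewrite -(setCK K); apply: measurableC; exact: sub_sigma_algebra.
exists mu; split.
  (* Each [m L] vanishes on the complement of [K], and this complement is open, so the bound reaches
     [mu]. *)
  have : (mu (~` K) <= 0)%E.
    rewrite (le_trans (mu_le _ oK))// lee_fin; apply: phi_le.
    apply: nearW => L; have [_ psK _ _] := psP L.
    rewrite /m /mass big_seq big1 ?mul0r// => p /psK Kp.
    by rewrite indicE memNset ?mulr0//=; exact.
  rewrite probability_setC// => h.
  apply/eqP; rewrite eq_le probability_le1//=.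
  by move: h; rewrite leeBlDr ?fin_num_measure// add0e.
move=> n x Nn; rewrite (le_trans (mu_le _ (open_bowen_ball cT _ _ _)))//.
(* For fixed [n] the weights of index [L] obey the bound once [n <= N + L], so the limit obeys it
   for all [n >= N]. Normalization costs at most a factor [c^-1]. *)
rewrite lee_fin; apply: phi_le; near=> L.
have [_ _ cM mass_le] := psP L.
apply: ler_pM => //; [|by rewrite invr_ge0 ltW| |].
- by apply: mass_ge0; have [] := psP L.
- apply: mass_le; rewrite Nn/= (@leq_trans L)// ?leq_addl//.
  by near: L; exists n.
- by rewrite lef_pV2// posrE.
Unshelve. all: by end_near.
Qed.

End frostman.

(** * Bounds on lower limits and on local entropies *)

Section limn_einf_bounds.
Context {R : realType}.
Implicit Types (u : nat -> \bar R) (t : \bar R).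
Local Open Scope ereal_scope.

Lemma limn_einf_ge u t : (\forall n \near \oo, t <= u n) -> t <= limn_einf u.
Proof.
move=> [N _ uN]; rewrite limn_einf_lim (cvg_lim _ (@cvg_einfs_sup _ u))//.
rewrite (@le_trans _ _ (einfs u N))//; last by apply: ereal_sup_ubound; exists N.
by apply: le_ereal_inf_tmp => _ [n /= Nn <-]; exact: uN.
Qed.

Lemma limn_einf_le u t :
  (forall N, exists n, (N <= n)%N /\ u n <= t) -> limn_einf u <= t.
Proof.
move=> ut; rewrite limn_einf_lim (cvg_lim _ (@cvg_einfs_sup _ u))//.
apply: ge_ereal_sup => _ [N _ <-]; have [n [Nn unt]] := ut N.
by rewrite (le_trans _ unt)//; apply: ereal_inf_lbound; exists n.
Qed.

Lemma local_entropy_le (m : \bar R) (s : R) n : (0 < n)%N ->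
  (expR (- (n%:R * s)))%:E <= m -> - lne m * (n%:R^-1)%:E <= s%:E.
Proof.
move=> n0 ms; have n0' : (0 < n%:R :> R)%R by rewrite ltr0n.
have -> : s%:E = (n%:R * s)%:E * (n%:R^-1)%:E.
  by rewrite -EFinM mulrAC divff ?mul1r// gt_eqF.
apply: lee_wpmul2r; first by rewrite lee_fin invr_ge0 ltW.
rewrite leeNl -EFinN; case: m ms => [r| |]//=; rewrite ?leey// lee_fin => rs.
have r0 := lt_le_trans (expR_gt0 _) rs.
have [r0'|_] := leP r 0%R; first by move: r0; rewrite ltNge r0'.
by rewrite lee_fin -ler_expR lnK.
Qed.

Lemma local_entropy_ge (m : \bar R) (s : R) n : (0 < n)%N ->
  m <= (expR (- (n%:R * s)))%:E -> s%:E <= - lne m * (n%:R^-1)%:E.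
Proof.
move=> n0 ms; have n0' : (0 < n%:R :> R)%R by rewrite ltr0n.
have -> : s%:E = (n%:R * s)%:E * (n%:R^-1)%:E.
  by rewrite -EFinM mulrAC divff ?mul1r// gt_eqF.
apply: lee_wpmul2r; first by rewrite lee_fin invr_ge0 ltW.
rewrite leeNr -EFinN; case: m ms => [r| |]//=; rewrite ?leNye// lee_fin => rs.
(* A ball of mass zero has logarithm [-oo], hence infinite local entropy. *)
have [r0|r0] := leP r 0%R; first exact: leNye.
by rewrite lee_fin -ler_expR lnK.
Qed.

End limn_einf_bounds.

(* The integrand need not be measurable: the integral of a nonnegative function
   is a supremum over the simple functions below it. *)
Section nonmeasurable_integral.
Import HBNNSimple.
Context d (T : measurableType d) (R : realType) (mu : probability T R).
Local Open Scope ereal_scope.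

Lemma integral_ge_cst (f : T -> \bar R) (s : R) : (0 <= s)%R ->
  (forall x, s%:E <= f x) -> s%:E <= \int[mu]_x f x.
Proof.
move=> s0 sf; rewrite ge0_integralTE; last first.
  by move=> x; rewrite (le_trans _ (sf x)).
pose h := cst_nnsfun T (NngNum s0); apply: ereal_sup_ubound; exists h => //.
by rewrite -(integralT_nnsfun mu h)/= integral_cst//= probability_setT mule1.
Qed.

Lemma integral_le_cst (f : T -> \bar R) (s : R) (N : set T) : (0 <= s)%R ->
  measurable N -> mu N = 0 -> (forall x, 0 <= f x) ->
  (forall x, ~ N x -> f x <= s%:E) -> \int[mu]_x f x <= s%:E.
Proof.
move=> s0 mN N0 f0 fs; rewrite ge0_integralTE//.
apply: ge_ereal_sup => _ [h hf <-]; rewrite -integralT_nnsfun.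
have -> : s%:E = \int[mu]_x (cst s%:E) x.
  by rewrite integral_cst//= probability_setT mule1.
apply: ae_ge0_le_integral => //.
- by move=> x _; rewrite lee_fin; exact: fun_ge0.
- by apply/measurable_EFinP; exact: measurable_funPT.
- exists N; split => // x /= hs; apply: contrapT => Nx; apply: hs => _.
  exact: le_trans (hf x) (fs x Nx).
Qed.

End nonmeasurable_integral.

Lemma measurable_open (R : realType) (X : pmetricType R) (U : set X) : open U ->
  measurable (U : set (borel X)).
Proof. by move=> oU; exact: sub_sigma_algebra. Qed.

(** * Monotonicity in the scale and inequalities for a fixed measure *)

Section entropy_comparison.
Context {R : realType} {X : pmetricType R} (T : X -> X).
Hypothesis cT : continuous T.
Local Open Scope ereal_scope.

Lemma open_neutralized_ball n (eps : R) x : open (neutralized_ball T n eps x).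
Proof. exact: open_bowen_ball. Qed.

Lemma measurable_neutralized_ball n (eps : R) x :
  measurable (neutralized_ball T n eps x : set (borel X)).
Proof. by apply: measurable_open; exact: open_neutralized_ball. Qed.

Lemma family_inf_ge0 P N (eps s : R) : 0 <= family_inf T P N eps s.
Proof.
apply: le_ereal_inf_tmp => _ [I [n [x [_ _ ->]]]].
by apply: esum_ge0 => i _; rewrite lee_fin expR_ge0.
Qed.

Lemma family_inf_nondecreasing P (eps s : R) :
  {homo (fun N => family_inf T P N eps s) : N M / (N <= M)%N >-> N <= M}.
Proof.
move=> N M NM; apply: ereal_inf_le_tmp => _ [I [n [x [In PI ->]]]].
exists I, n, x; split => // i /In[n0 Mn]; split => //.
exact: leq_trans Mn.
Qed.

Lemma family_lim_sup P (eps s : R) :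
  family_lim T P eps s = ereal_sup (range (fun N => family_inf T P N eps s)).
Proof.
apply/cvg_lim => //; apply: ereal_nondecreasing_cvgn.
exact: family_inf_nondecreasing.
Qed.

Lemma family_lim_ge0 P (eps s : R) : 0 <= family_lim T P eps s.
Proof.
rewrite family_lim_sup (le_trans (family_inf_ge0 P 0 eps s))//.
by apply: ereal_sup_ubound; exists 0%N.
Qed.

(** A smaller [eps] gives larger balls with the same weights. The implication from [P] to [Q] is
    asked for open sets only, so that it can be a statement about [mu], whose monotonicity requires
    measurable sets. *)
Lemma le_family_lim (P Q : set X -> Prop) (eps1 eps2 s : R) :
  (forall U V, open U -> open V -> U `<=` V -> P U -> Q V) -> (eps1 <= eps2)%R ->
  family_lim T Q eps1 s <= family_lim T P eps2 s.
Proof.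
move=> PQ e12; rewrite !family_lim_sup; apply: ge_ereal_sup => _ [N _ <-].
apply: (@le_trans _ _ (family_inf T P N eps2 s)); last first.
  by apply: ereal_sup_ubound; exists N.
apply: ereal_inf_le_tmp => _ [I [n [x [In PI ->]]]].
exists I, n, x; split => //; apply: PQ PI.
- by apply: bigcup_open => i _; exact: open_neutralized_ball.
- by apply: bigcup_open => i _; exact: open_neutralized_ball.
apply: subset_bigcup => i _ y; rewrite /neutralized_ball/= => /lt_le_trans; apply.
by rewrite ler_expR lerN2 ler_wpM2l.
Qed.

Lemma critical_value_ge0 (m : R -> \bar R) : 0 <= critical_value m.
Proof. by apply: le_ereal_inf_tmp => _ [s [s0 _] <-]. Qed.

Lemma le_critical_value (m1 m2 : R -> \bar R) :
  (forall s, 0 <= m1 s) -> (forall s, m1 s <= m2 s) ->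
  critical_value m1 <= critical_value m2.
Proof.
move=> m0 m12; apply: ereal_inf_le_tmp => _ [s [s0 ms] <-]; exists s => //.
by split => //; apply/eqP; rewrite eq_le m0 -ms m12.
Qed.

Lemma le_bowen_entropy_at (K : set X) (eps1 eps2 : R) : (eps1 <= eps2)%R ->
  bowen_entropy_at T K eps1 <= bowen_entropy_at T K eps2.
Proof.
move=> e12; apply: le_critical_value => s; first exact: family_lim_ge0.
by apply: le_family_lim => // U V _ _ UV KU; exact: subset_trans UV.
Qed.


Section with_measure.
Variable mu : probability (borel X) R.

Lemma le_mu_open (U V : set X) : open U -> open V -> U `<=` V -> mu U <= mu V.
Proof.
move=> oU oV UV.
by apply: le_measure => //; apply/mem_set; exact: measurable_open.
Qed.

Lemma katok_entropy_sup (eps : R) : katok_entropy T mu eps =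
  ereal_sup [set katok_entropy_at T mu eps delta | delta in `]0%R, 1%R[ ].
Proof.
apply/cvg_lim => //.
apply: (@nonincreasing_at_right_cvge _ _ _ (BLeft 1%R)).
  by rewrite bnd_simp.
move=> d1 d2 _ _ d12; apply: le_critical_value => s; first exact: family_lim_ge0.
apply: le_family_lim => // U V oU oV UV /lt_le_trans/(_ (le_mu_open oU oV UV)).
by apply: le_lt_trans; rewrite lee_fin lerB.
Qed.

(** The union of a cover of [K] has measure 1, above [1 - delta], so every family competing for the
    Bowen entropy also competes for the Katok entropy. *)
Lemma katok_le_bowen (K : set X) (eps : R) : compact K -> mu K = 1 ->
  katok_entropy T mu eps <= bowen_entropy_at T K eps.
Proof.
move=> cK mK1; rewrite katok_entropy_sup.
apply: ge_ereal_sup => _ [delta d01 <-].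
move: d01; rewrite /= in_itv/= => /andP[d0 d1].
apply: le_critical_value => s; first exact: family_lim_ge0.
apply: le_family_lim => // U V oU oV UV KU.
apply: (@lt_le_trans _ _ (mu K)); first by rewrite mK1 lte_fin ltrBlDr ltrDl.
have cK' : closed K by apply: compact_closed => //; exact: metric_hausdorff.
apply: le_measure; last exact: subset_trans UV.
  apply/mem_set; rewrite -(setCK K); apply: measurableC.
  by apply: measurable_open; exact: closed_openC.
by apply/mem_set; exact: measurable_open.
Qed.

(** Below [s] there is an exponent [t] at which the limit in [N] vanishes. The infima are
    nondecreasing in [N], so each of them is at most 0 at [t], and passing from [t] to [s] only
    lowers the weights. *)
Lemma small_family (eps s delta eta : R) k : (0 <= s)%R -> (0 < eta)%R ->
  katok_entropy_at T mu eps delta < s%:E ->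
  exists (I : set nat) (n : nat -> nat) (x : nat -> X),
    [/\ forall i, I i -> (0 < n i)%N /\ (k <= n i)%N,
        (1 - delta)%:E < mu (\bigcup_(i in I) neutralized_ball T (n i) eps (x i)) &
        \esum_(i in I) (expR (- ((n i)%:R * s)))%:E < eta%:E].
Proof.
move=> s0 eta0 /ereal_inf_lt[_ [t [t0 lim0] <-]]; rewrite lte_fin => ts.
move: lim0; rewrite family_lim_sup => sup0.
have : family_inf T (fun U => (1 - delta)%:E < mu U) k eps t < eta%:E.
  rewrite (@le_lt_trans _ _ 0)// -sup0.
  by apply: ereal_sup_ubound; exists k.
move=> /ereal_inf_lt[_ [I [n [x [In mu_gt ->]]]] lt_eta].
exists I, n, x; split => //; apply: le_lt_trans lt_eta.
apply: le_esum => i Ii; rewrite lee_fin ler_expR lerN2.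
by rewrite ler_wpM2l// ltW.
Qed.

Lemma measure_bigcup_esum (I : set nat) (B : nat -> set X) (a : nat -> \bar R) :
  (forall i, open (B i)) -> (forall i, I i -> mu (B i) <= a i) ->
  (forall i, 0 <= a i) ->
  mu (\bigcup_(i in I) B i) <= \esum_(i in I) a i.
Proof.
move=> oB Ba a0.
have mB i : measurable (B i : set (borel X)) by exact: measurable_open.
rewrite bigcup_mkcond esum_mkcond -nneseries_esumT; last first.
  by move=> i; case: ifP.
apply: le_trans (@measure_sigma_subadditive _ _ _ mu _
  (fun i => if i \in I then B i else set0) _ _ _) _.
- by move=> i; case: ifP.
- by apply: bigcupT_measurable => i; case: ifP.
- by [].
apply: lee_nneseries => [i _ _|i _]; first exact: measure_ge0.
by case: ifPn => [/set_mem/Ba//|_]; rewrite measure0.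
Qed.

Lemma lower_local_entropy_ge0 (eps : R) (x : X) :
  0 <= limn_einf (fun n =>
    - lne (mu (neutralized_ball T n eps x)) * (n%:R^-1)%:E).
Proof.
apply: limn_einf_ge; apply: nearW => n.
rewrite mule_ge0// ?lee_fin ?invr_ge0// oppe_ge0 lne_le0.
by rewrite probability_le1//; exact: measurable_neutralized_ball.
Qed.

Lemma brin_katok_ge0 (eps : R) : 0 <= lower_brin_katok_entropy T mu eps.
Proof. by apply: integral_ge0 => x _; exact: lower_local_entropy_ge0. Qed.

Lemma brin_katok_ge (eps s c : R) N : (0 <= s)%R -> (0 < c)%R ->
  (forall n x, (N <= n)%N ->
    mu (neutralized_ball T n eps x) <= (expR (- (n%:R * s)) / c)%:E) ->
  s%:E <= lower_brin_katok_entropy T mu eps.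
Proof.
move=> s0 c0 mu_le; apply: integral_ge_cst => // x.
apply/lee_addgt0Pr => e e0; rewrite -leeBlDr// -EFinB.
(* Beyond this rank [c^-1 <= n e <= expR (n e)], so the constant [c] costs at most [e] in the
   exponent. The successor keeps [n] positive. *)
apply: limn_einf_ge; exists (maxn N (Num.bound (c^-1 / e))).+1 => // n /= Nn.
have n0 : (0 < n)%N by exact: leq_trans Nn.
apply: local_entropy_ge => //; apply: le_trans (mu_le n x _) _.
  by rewrite (leq_trans _ Nn)// (leq_trans (leq_maxl _ _) (leqnSn _)).
rewrite lee_fin mulrBr opprB expRD mulrC ler_pM2r ?expR_gt0//.
apply: le_trans (expR_ge1Dx _).
have : (c^-1 / e <= n%:R)%R.
  apply: le_trans (ltW (archi_boundP _)) _.
    by rewrite divr_ge0// ?invr_ge0 ltW.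
  by rewrite ler_nat (leq_trans _ Nn)// (leq_trans (leq_maxr _ _) (leqnSn _)).
rewrite ler_pdivrMr// => h; lra.
Qed.

Lemma brin_katok_le_katok (eps : R) : (0 < eps)%R ->
  lower_brin_katok_entropy T mu (eps / 2) <= katok_entropy T mu eps.
Proof.
move=> eps0.
have [->|kfin] := eqVneq (katok_entropy T mu eps) +oo; first by rewrite leey.
have katok_ge (delta : R) : (0 < delta < 1)%R ->
    katok_entropy_at T mu eps delta <= katok_entropy T mu eps.
  move=> d01; rewrite katok_entropy_sup; apply: ereal_sup_ubound.
  by exists delta => //=; rewrite in_itv.
have k0 : 0 <= katok_entropy T mu eps.
  apply: le_trans (katok_ge 2^-1%R _); first exact: critical_value_ge0.
  by apply/andP; split; lra.
apply/lee_addgt0Pr => e e0.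
have [k kE] : exists k, katok_entropy T mu eps = k%:E.
  exists (fine (katok_entropy T mu eps)); rewrite fineK// fin_numElt.
  by rewrite (lt_le_trans _ k0) ?ltNy0//= ltey.
rewrite kE lee_fin in k0; rewrite kE -EFinD.
have s0 : (0 <= k + e)%R by rewrite addr_ge0// ltW.
set s := (k + e)%R in s0 *.
(* Half of the summable sequence [1 / 2 ^ j.+1]: the complement of [G j] below loses [eta j] twice,
   once for the points that the family misses and once for the light balls. *)
pose eta j : R := (2^-1 / (2 ^ j.+1)%:R)%R.
have eta0 j : (0 < eta j)%R by rewrite divr_gt0// ltr0n expn_gt0.
have eta1 j : (eta j < 1)%R.
  rewrite ltr_pdivrMr ?ltr0n ?expn_gt0// mul1r.
  by rewrite (@lt_le_trans _ _ 1%R)// ?ler1n ?expn_gt0//; lra.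
pose Q j (p : set nat * (nat -> nat) * (nat -> X)) :=
  [/\ forall i, p.1.1 i -> (0 < p.1.2 i)%N /\ (j <= p.1.2 i)%N,
      (1 - eta j)%:E <
        mu (\bigcup_(i in p.1.1) neutralized_ball T (p.1.2 i) eps (p.2 i)) &
      \esum_(i in p.1.1) (expR (- ((p.1.2 i)%:R * s)))%:E < (eta j)%:E].
have /choice[p pQ] j : exists p, Q j p.
  have [|I [n [x ?]]] := @small_family eps s (eta j) (eta j) j s0 (eta0 j).
    rewrite (le_lt_trans (katok_ge _ _)) ?eta0 ?eta1//.
    by rewrite kE lte_fin ltrDl.
  by exists (I, n, x).
pose I j := (p j).1.1; pose n j := (p j).1.2.
pose B j i := neutralized_ball T (n j i) eps ((p j).2 i).
(* The balls that are not heavy have total mass at most the sum of the weights, which is below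
   [eta j]; discarding them is therefore cheap. *)
pose heavy j := [set i | I j i /\ (expR (- ((n j i)%:R * s)))%:E < mu (B j i)].
pose G j : set (borel X) := \bigcup_(i in heavy j) B j i.
have oB j i : open (B j i) by exact: open_neutralized_ball.
have mG j : measurable (G j).
  by apply: measurable_open; apply: bigcup_open => i _; exact: oB.
have muG j : mu (~` G j) <= (1 / (2 ^ j.+1)%:R)%:E.
  have [_ mu_gt sum_lt] := pQ j.
  have mu_light : mu (\bigcup_(i in I j `\` heavy j) B j i) <= (eta j)%:E.
    apply: le_trans (ltW sum_lt).
    apply: (@le_trans _ _
        (\esum_(i in I j `\` heavy j) (expR (- ((n j i)%:R * s)))%:E)).
      apply: measure_bigcup_esum => // i [Ii nh].
      by rewrite leNgt; apply/negP => Bi; apply: nh.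
    rewrite esum_mkcond [leRHS]esum_mkcond; apply: le_esum => i _.
    case: ifPn => [/set_mem[Ii _]|_]; first by rewrite mem_set.
    by case: ifP; rewrite ?lee_fin ?expR_ge0.
  have : (1 - eta j)%:E < mu (G j) + (eta j)%:E.
    apply: (lt_le_trans mu_gt).
    apply: (@le_trans _ _ (mu (G j `|` \bigcup_(i in I j `\` heavy j) B j i))).
      apply: le_mu_open.
      - by apply: bigcup_open => i _; exact: oB.
      - by apply: openU; apply: bigcup_open => i _; exact: oB.
      - move=> x [i Ii Bx]; have [hi|nhi] := pselect (heavy j i).
          by left; exists i.
        by right; exists i.
    rewrite (le_trans (measureU2 _ _ _))//.
      by apply: measurable_open; apply: bigcup_open => i _; exact: oB.
    by rewrite leeD2l.
  rewrite probability_setC//.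
  have : mu (G j) \is a fin_num by rewrite fin_num_measure.
  move=> /fineK <-; rewrite -EFinD -EFinB lte_fin lee_fin.
  have : (eta j + eta j = 1 / (2 ^ j.+1)%:R)%R.
    by rewrite /eta -mulrDl; congr (_ / _)%R; lra.
  lra.
pose N := lim_sup_set (fun j => ~` G j).
have mN : measurable N.
  apply: bigcap_measurable => // j _; apply: bigcup_measurable => i _.
  exact: measurableC.
have N0 : mu N = 0.
  apply: lim_sup_set_cvg0 => [j|]; first exact: measurableC.
  rewrite (@le_lt_trans _ _ 1%:E) ?ltry//.
  apply: (le_trans _ (@epsilon_trick0 R 1%R xpredT ler01)).
  by apply: lee_nneseries => [j _ _|j _]; [exact: measure_ge0|exact: muG].
apply: (integral_le_cst s0 mN N0) => [x|x Nx].
  exact: lower_local_entropy_ge0.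
have [j0 Gx] : exists j0, forall j, (j0 <= j)%N -> G j x.
  apply: contrapT => nG; apply: Nx => j0 _.
  apply: contrapT => nU; apply: nG; exists j0 => j j0j.
  by apply: contrapT => nGj; apply: nU; exists j.
apply: limn_einf_le => M.
(* From time [m0] on, twice the radius at scale [eps] is at most the radius at scale [eps / 2]. This
   allows a heavy ball to be recentred at [x]. *)
have [m0 m02] : exists m0, forall m, (m0 <= m)%N ->
    (2 <= expR (m%:R * (eps / 2)))%R.
  exists (Num.bound (2 / eps)) => m m0m.
  rewrite (le_trans _ (expR_ge1Dx _))//.
  have : (2 / eps <= m%:R)%R.
    apply: le_trans (ltW (archi_boundP _)) _; first by rewrite divr_ge0// ltW.
    by rewrite ler_nat.
  rewrite ler_pdivrMr// => h; lra.
(* The family of index [j] only uses times at least [j], so the heavy ball through [x] occurs after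
   both [M] and [m0]. *)
pose j := maxn j0 (maxn M m0).
have [i [Ii Bi] Bix] := Gx j (leq_maxl _ _).
have [inI _ _] := pQ j; have [ni0 nij] := inI i Ii.
have Mn : (M <= n j i)%N by rewrite (leq_trans _ nij)// /j leq_max leq_maxl orbT.
exists (n j i); split => //; apply: local_entropy_le => //.
apply: le_trans (ltW Bi) _; apply: le_mu_open => //.
  exact: open_neutralized_ball.
move=> y; rewrite /B/neutralized_ball/= in Bix *.
have h1 := bowen_dist_triangle T (n j i) x ((p j).2 i) y.
rewrite bowen_dist_sym in Bix => h2.
have h3 : (expR (- ((n j i)%:R * eps)) *+ 2 <=
    expR (- ((n j i)%:R * (eps / 2))))%R.
  rewrite {1}[eps]splitr mulrDr opprD expRD -mulrnAl.
  rewrite ler_piMl ?expR_ge0// expRN -mulr_natl ler_pdivrMr ?expR_gt0// mul1r.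
  by apply: m02; rewrite (leq_trans _ nij)// /j !leq_max leqnn !orbT.
lra.
Qed.

End with_measure.
End entropy_comparison.

(** * Suprema over the measures carried by [K], and the final squeeze *)

Section variational_principle.
Context {R : realType} {X : pmetricType R} (T : X -> X) (K : set X).
Hypotheses (cX : compact [set: X]) (cT : continuous T).
Hypotheses (cK : compact K) (K0 : K !=set0).
Local Open Scope ereal_scope.

Let carried := [set mu : probability (borel X) R | mu K = 1].
Let sup_brin_katok (eps : R) :=
  ereal_sup [set lower_brin_katok_entropy T mu eps | mu in carried].
Let sup_katok (eps : R) :=
  ereal_sup [set katok_entropy T mu eps | mu in carried].

(** Since the supremum of the empty set is [-oo] in the extended reals, a carried measure must be
    exhibited: a Dirac mass at a point of [K]. *)
Lemma sup_brin_katok_ge0 (eps : R) : 0 <= sup_brin_katok eps.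
Proof.
have [x Kx] := K0.
pose mu : probability (borel X) R := @dirac _ (borel X) x R.
apply: (le_trans (brin_katok_ge0 cT mu eps)); apply: ereal_sup_ubound.
by exists mu => //; rewrite /carried /mu /= diracE mem_set.
Qed.

(** If the inequality failed by more than [e], the covering number would be positive at an exponent
    above the supremum. [frostman] at scale [eps / 2] takes this as input at scale [eps / 4] and
    returns a measure whose local entropies at scale [eps] exceed the supremum. *)
Lemma bowen_le_sup_brin_katok (eps : R) : (0 < eps)%R ->
  bowen_entropy_at T K (eps / 4) <= sup_brin_katok eps.
Proof.
move=> eps0; have [->|supfin] := eqVneq (sup_brin_katok eps) +oo.
  by rewrite leey.
have sup0 := sup_brin_katok_ge0 eps.
have [a aE] : exists a, sup_brin_katok eps = a%:E.
  exists (fine (sup_brin_katok eps)); rewrite fineK// fin_numElt.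
  by rewrite (lt_le_trans _ sup0) ?ltNy0//= ltey.
rewrite aE; rewrite aE lee_fin in sup0.
apply/lee_addgt0Pr => e e0; rewrite -EFinD leNgt; apply/negP => lt_bowen.
have s0 : (0 <= a + e)%R by rewrite addr_ge0// ltW.
have : 0 < family_lim T (fun U => K `<=` U) (eps / 4) (a + e).
  rewrite lt_neqAle family_lim_ge0// andbT; apply/negP => /eqP lim0.
  move: lt_bowen; rewrite ltNge => /negP; apply.
  by apply: ereal_inf_lbound; exists (a + e)%R.
rewrite family_lim_sup => /ereal_sup_gt[_ [N1 _ <-] inf_gt0].
(* With [N >= 3 / (eps / 4)] one has [4 <= 1 + N (eps / 4)], and the exponential is at least the
   right side. The successor makes [N] positive. *)
pose N := maxn N1 (Num.bound (3 / (eps / 4))).+1.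
(* The infimum may be [+oo], in which case any positive real serves as [c]. *)
have [c [c0 cN1]] : exists c : R, (0 < c)%R /\
    c%:E <= family_inf T (fun U => K `<=` U) N1 (eps / 4) (a + e).
  case: family_inf inf_gt0 => [r||]// r0; last by exists 1%R; rewrite leey.
  by exists r.
have eps4 : (eps / 4 = eps / 2 / 2)%R by lra.
have N4 : (4 <= expR (N%:R * (eps / 2 / 2)))%R.
  apply: le_trans (expR_ge1Dx _); rewrite -eps4.
  have : (3 / (eps / 4) <= N%:R)%R.
    apply: le_trans (ltW (archi_boundP _)) _.
      by rewrite divr_ge0// ltW// divr_gt0.
    by rewrite ler_nat (leq_trans (leqnSn _) (leq_maxr _ _)).
  rewrite ler_pdivrMr ?divr_gt0// => h; lra.
have N0 : (0 < N)%N by rewrite /N leq_max orbT.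
have cN : c%:E <= family_inf T (fun U => K `<=` U) N (eps / 2 / 2) (a + e).
  rewrite -eps4 (le_trans cN1)//; apply: family_inf_nondecreasing.
  exact: leq_maxl.
have [mu [muK mu_le]] :=
  frostman cT cK (divr_gt0 eps0 (ltr0Sn _ 1)) N0 N4 cN cX c0.
have eps2 : (eps / 2 *+ 2 = eps)%R by lra.
rewrite eps2 in mu_le.
have := brin_katok_ge s0 c0 mu_le.
apply/negP; rewrite -ltNge (@le_lt_trans _ _ a%:E)//; last first.
  by rewrite lte_fin ltrDl.
by rewrite -aE; apply: ereal_sup_ubound; exists mu.
Qed.

Lemma sup_brin_katok_le_sup_katok (eps : R) : (0 < eps)%R ->
  sup_brin_katok (eps / 2) <= sup_katok eps.
Proof.
move=> eps0; apply: ge_ereal_sup => _ [mu muK <-].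
rewrite (le_trans (brin_katok_le_katok cT mu eps0))//.
by apply: ereal_sup_ubound; exists mu.
Qed.

Lemma sup_katok_le_bowen (eps : R) : sup_katok eps <= bowen_entropy_at T K eps.
Proof. by apply: ge_ereal_sup => _ [mu muK <-]; exact: katok_le_bowen. Qed.

(** The limit exists by monotonicity in [eps], and a positive rescaling preserves the right
    neighbourhoods of 0. The constant factors on the scale are thus harmless in the squeeze. *)
Lemma bowen_entropy_at_cvg (a : R) : (0 < a)%R ->
  bowen_entropy_at T K (eps * a)%R @[eps --> 0^'+] --> bowen_entropy T K.
Proof.
move=> a0.
have cvg1 : bowen_entropy_at T K eps @[eps --> 0^'+] --> bowen_entropy T K.
  apply: nondecreasing_at_right_is_cvge; near=> x => y z _ _.
  exact: le_bowen_entropy_at.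
have scale : (fun eps : R => eps * a)%R @ 0^'+ --> 0^'+.
  move=> P [/= e e0 eP]; exists (e / a)%R; rewrite /= ?divr_gt0// => y /=.
  rewrite sub0r normrN => ye y0; apply: eP => /=; last by rewrite mulr_gt0.
  by rewrite sub0r normrN normrM (gtr0_norm a0) -ltr_pdivlMr.
exact: cvg_comp scale cvg1.
Unshelve. all: by end_near.
Qed.

End variational_principle.

Theorem theorem1p1 (R : realType) (X : pmetricType R) (T : X -> X)
    (K : set X) :
  compact [set: X] -> continuous T -> compact K -> K !=set0 ->
  ereal_sup [set lower_brin_katok_entropy T mu eps
            | mu in [set mu : probability (borel X) R | mu K = 1%E]]
      @[eps --> 0^'+] --> bowen_entropy T K
  /\
  ereal_sup [set katok_entropy T mu eps
            | mu in [set mu : probability (borel X) R | mu K = 1%E]]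
      @[eps --> 0^'+] --> bowen_entropy T K.
Proof.
move=> cX cT cK K0.
have cvgM := bowen_entropy_at_cvg (K := K) cT.
split.
(* The lower bound is the Frostman inequality; the upper one goes through the Katok supremum at
   scale [2 eps], which the Bowen entropy at that scale dominates. *)
- apply: (squeeze_cvge _ (cvgM 4^-1 _) (cvgM 2 _)) => //.
  near=> eps; have eps0 : 0 < eps by near: eps; exact: nbhs_right_gt.
  rewrite bowen_le_sup_brin_katok//=.
  have eps20 : 0 < eps * 2 by rewrite mulr_gt0.
  have := sup_brin_katok_le_sup_katok K cT eps20; rewrite mulfK// => /le_trans.
  by apply; exact: sup_katok_le_bowen.
(* The factor 8 combines the 2 lost from Katok to Brin-Katok with the 4 lost from Brin-Katok to
   Bowen. *)
- apply: (squeeze_cvge _ (cvgM 8^-1 _) (cvgM 1 _)) => //.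
  near=> eps; have eps0 : 0 < eps by near: eps; exact: nbhs_right_gt.
  rewrite mulr1 sup_katok_le_bowen// andbT.
  have eps20 : 0 < eps / 2 by rewrite divr_gt0.
  have -> : eps / 8 = eps / 2 / 4 by lra.
  apply: le_trans (sup_brin_katok_le_sup_katok K cT eps0).
  exact: bowen_le_sup_brin_katok.
Unshelve. all: by end_near.
Qed.
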